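(* Let $t\in\mathbb{R}\setminus\mathbb{Z}_{\ge0}$ and $r>0$, and let $\mathfrak{Q}=\{Q_s\}_{s\ge0}\subset\mathcal{A}_r^{(t)}$ be a $\boxplus^t$-semigroup. Assume that the limit $$\eta_{\mathfrak{Q}}(z):=\lim_{s\to0^+}\frac{\Phi_t(Q_s)(z)-1}{s}$$ exists for each $z\in\mathbb{D}_r=\{z:|z|<r\}$. Then $$\mathcal{L}_r^{(t)}[\mathfrak{Q}]=\Phi_t^{-1}\circ\mathbf{M}_{\eta_{\mathfrak{Q}}(z)}\circ\Phi_t,$$ and its domain is $$\mathrm{Dom}\bigl(\mathcal{L}_r^{(t)}[\mathfrak{Q}]\bigr)=\left\{A\in\mathcal{A}_r^{(t)}:\ \eta_{\mathfrak{Q}}(\cdot)\,\Phi_t(A)\in\mathcal{A}_r\right\}.$$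
   Context: $(t)_{\underline{k}}=t(t-1)\cdots(t-k+1)$. For $A=\sum a_kz^k$, $B=\sum b_kz^k$ in $\mathbb{R}\llbracket z\rrbracket$, $(A\boxplus^tB)(z)=\sum_{k\ge0}\sum_{i+j=k}\frac{(t)_{\underline{k}}}{(t)_{\underline{i}}(t)_{\underline{j}}}a_ib_jz^k$. $\mathcal{A}_r=\{\sum a_kz^k\in\mathbb{R}\llbracket z\rrbracket:\|\sum a_kz^k\|_r:=\sum_{k}|a_k|r^k<\infty\}$ and $\mathcal{A}_r^{(t)}=\{\sum a_kz^k\in\mathbb{R}\llbracket z\rrbracket:\|\sum a_kz^k\|_r^{(t)}:=\sum_k|a_k/(t)_{\underline{k}}|r^k<\infty\}$, with these norms. The map $\Phi_t:\mathcal{A}_r^{(t)}\to\mathcal{A}_r$, $\Phi_t(\sum a_kz^k)=\sum\frac{a_k}{(t)_{\underline{k}}}z^k$, is a bijection with inverse $\Phi_t^{-1}$; elements of $\mathcal{A}_r$ converge absolutely on $\mathbb{D}_r$ and are identified with the functions they define there. A family $\mathfrak{Q}=\{Q_s\}_{s\ge0}\subset\mathcal{A}_r^{(t)}$ is a $\boxplus^t$-semigroup if $Q_0=1$, $Q_{s_1}\boxplus^tQ_{s_2}=Q_{s_1+s_2}$ for all $s_1,s_2\ge0$, and $\|Q_s-1\|_r^{(t)}\to0$ as $s\to0^+$. With $T_sA:=A\boxplus^tQ_s$ on $\mathcal{A}_r^{(t)}$, the $(t,r)$-deformed infinitesimal generator is $\mathcal{L}_r^{(t)}[\mathfrak{Q}]A:=\lim_{s\to0^+}\frac{T_sA-A}{s}$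 (limit in $\mathcal{A}_r^{(t)}$), with domain $\mathrm{Dom}(\mathcal{L}_r^{(t)}[\mathfrak{Q}])$ the set of $A\in\mathcal{A}_r^{(t)}$ for which the limit exists. $\mathbf{M}_{c(z)}$ is multiplication by $c(z)$: $(\mathbf{M}_{c(z)}A)(z)=c(z)A(z)$. *)

(* Defs.v *)
From Stdlib Require Import Reals Lra.
From Coquelicot Require Import Coquelicot.

Open Scope R_scope.

(* A formal power series in R[[z]] is its sequence of coefficients. *)
Notation fps := (nat -> R).

Definition fps_one : fps := fun k => match k with O => 1 | S _ => 0 end.

Fixpoint ffact (t : R) (k : nat) : R :=
  match k with
  | O => 1
  | S j => ffact t j * (t - INR j)
  end.

Definition boxplus (t : R) (a b : fps) : fps :=
  fun k => sum_f_R0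
    (fun i => ffact t k / (ffact t i * ffact t (k - i)) * a i * b (k - i)%nat) k.

Definition in_A (r : R) (a : fps) : Prop := ex_series (fun k => Rabs (a k) * r ^ k).

Definition in_At (t r : R) (a : fps) : Prop :=
  ex_series (fun k => Rabs (a k / ffact t k) * r ^ k).
(* Meaningful only under [in_At t r a]: [Series] has an irrelevant real value on
   a divergent series. *)
Definition norm_At (t r : R) (a : fps) : R :=
  Series (fun k => Rabs (a k / ffact t k) * r ^ k).

Definition Phi (t : R) (a : fps) : fps := fun k => a k / ffact t k.
Definition Phi_inv (t : R) (c : fps) : fps := fun k => ffact t k * c k.

(* The sum of the power series at a complex point, with [iota] selecting the
   unique limit; see [fps_eval_correct]. *)
Definition fps_eval (a : fps) (z : C) : C :=
  @iota C_CompleteNormedModule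
    (fun l => @is_pseries C_AbsRing C_NormedModule (fun k => RtoC (a k)) z l).

Lemma fps_eval_correct (r : R) (a : fps) (z : C) :
  in_A r a -> Cmod z < r ->
  @is_pseries C_AbsRing C_NormedModule (fun k => RtoC (a k)) z (fps_eval a z).
Proof.
  intros Ha Hz.
  assert (Hex : @ex_series C_AbsRing C_CompleteNormedModule
                  (fun k => scal (pow_n (z : C_AbsRing) k) (RtoC (a k)))).
  { apply (ex_series_le (K := C_AbsRing) (V := C_CompleteNormedModule)) with (2 := Ha).
    intro k.
    change (Cmod (Cmult (@pow_n C_AbsRing z k) (RtoC (a k)))
            <= Rabs (a k) * r ^ k).
    assert (Hp : Cmod (@pow_n C_AbsRing z k) = Cmod z ^ k).
    { induction k as [|k IH]; simpl.
      - apply Cmod_1.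
      - change (Cmod (Cmult z (@pow_n C_AbsRing z k)) = Cmod z * Cmod z ^ k).
        now rewrite Cmod_mult, IH. }
    rewrite Cmod_mult, Cmod_R, Hp, Rmult_comm.
    apply Rmult_le_compat_l; [apply Rabs_pos|].
    apply pow_incr; split; [apply Cmod_ge_0 | lra]. }
  destruct Hex as [l Hl].
  unfold fps_eval.
  apply (iota_correct (K := C_AbsRing) (V := C_CompleteNormedModule)
    (fun l => @is_pseries C_AbsRing C_NormedModule (fun k => RtoC (a k)) z l)).
  exists l; split; [exact Hl|].
  intros l' Hl'.
  exact (filterlim_locally_unique (K := C_AbsRing) (V := C_NormedModule) _ _ _ Hl Hl').
Qed.

(* Only the values [Q s] with [0 <= s] are relevant. *)
Definition boxplus_semigroup (t r : R) (Q : R -> fps) : Prop :=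
  (forall s, 0 <= s -> in_At t r (Q s)) /\
  Q 0 = fps_one /\
  (forall s1 s2, 0 <= s1 -> 0 <= s2 -> boxplus t (Q s1) (Q s2) = Q (s1 + s2)) /\
  filterlim (fun s => norm_At t r (PS_minus (Q s) fps_one)) (at_right 0) (locally 0).

Definition semigroup_op (t : R) (Q : R -> fps) (s : R) (A : fps) : fps :=
  boxplus t A (Q s).

(* Partially defined operators are represented by their graphs. *)
Definition operator := fps -> fps -> Prop.

Definition Dom (L : operator) (A : fps) : Prop := exists B, L A B.

(* The graph of the generator: B is the limit of (T_s A - A) / s in the norm
   of [in_At t r] as s -> 0+. *)
Definition generator (t r : R) (Q : R -> fps) : operator := fun A B =>
  in_At t r A /\ in_At t r B /\
  filterlim
    (fun s => norm_At t r
       (PS_minus (PS_scal (/ s) (PS_minus (semigroup_op t Q s A) A)) B))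
    (at_right 0) (locally 0).

(* The function f on the open disk of radius r is given by c, an element of
   the Banach space [in_A r]. *)
Definition represents (r : R) (f : C -> C) (c : fps) : Prop :=
  in_A r c /\ forall z : C, Cmod z < r -> f z = fps_eval c z.

Definition fun_in_A (r : R) (f : C -> C) : Prop := exists c, represents r f c.

Definition mul_fun (eta : C -> C) (a : fps) : C -> C :=
  fun z => Cmult (eta z) (fps_eval a z).

(* The graph of Phi_t^{-1} o M_eta o Phi_t with its natural domain. *)
Definition conj_mul (t r : R) (eta : C -> C) : operator := fun A B =>
  in_At t r A /\
  exists c, represents r (mul_fun eta (Phi t A)) c /\ B = Phi_inv t c.

(* Main.v *)
Require Import Defs.
From Stdlib Require Import Reals Lra Lia FunctionalExtensionality.
From Coquelicot Require Import Coquelicot.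

(** Under [Phi t] the deformed product becomes the ordinary Cauchy product, and
    [in_At t r] becomes the Banach algebra [in_A r].  So [q s = Phi t (Q s)] is a
    one-parameter semigroup of that algebra with [q s -> 1] in norm, and the
    classical fact about uniformly continuous semigroups applies: [q] is
    norm-differentiable at 0, with a derivative [g] in [in_A r].  The generator
    is then convolution by [g], defined on the whole space.  Pointwise
    evaluation turns [g] into [eta] and convolution into multiplication, and a
    power series is determined by its values on the disk; hence the operator
    conjugate to multiplication by [eta] is also convolution by [g], and both
    graphs coincide.

    Norm-differentiability is obtained without integrating in a Banach space.
    Put [u s = q s - 1].  The semigroup law gives [u (2h) = 2 u h + (u h)^2].
    When the norm of [u] is small this first forces [|u (h)| <= 2/3 |u (2h)|]
    ([norm_halving]), so the rescaled elements [2^n u (s / 2^n)] change by at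
    most a constant times [(8/9)^n |u s|^2] and converge ([dyadic_limit]) to
    some [L s], the logarithm of [q s], with [|L s - u s| <= 4 |u s|^2].
    The assumed pointwise limit identifies [L s] with the function [s eta] on
    the disk ([dyadic_limit_eval]), so [L s = s g] with [g] independent of [s].
    The quadratic estimate then gives [|u s| = O(s)], and therefore
    [u s / s -> g] in norm ([generator_of_halving]). *)

(** * The weighted l1 norm *)

Definition norm_A (r : R) (a : fps) : R := Series (fun k => Rabs (a k) * r ^ k).

Lemma weight_nonneg (r x : R) (k : nat) : 0 <= r -> 0 <= Rabs x * r ^ k.
Proof.
  intro Hr; apply Rmult_le_pos; [apply Rabs_pos | now apply pow_le].
Qed.

Lemma sum_n_le_Series (u : nat -> R) (n : nat) :
  (forall k, 0 <= u k) -> ex_series u -> sum_n u n <= Series u.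
Proof.
  intros Hu Hex.
  apply (is_lim_seq_incr_compare (sum_n u)).
  - exact (Series_correct u Hex).
  - intro m; rewrite sum_Sn; specialize (Hu (S m)); unfold plus; simpl; lra.
Qed.

Lemma ex_series_of_bounded (u : nat -> R) (M : R) :
  (forall k, 0 <= u k) -> (forall n, sum_n u n <= M) ->
  ex_series u /\ Series u <= M.
Proof.
  intros Hu HM.
  destruct (ex_finite_lim_seq_incr (sum_n u) M) as [l Hl].
  - intro m; rewrite sum_Sn; specialize (Hu (S m)); unfold plus; simpl; lra.
  - exact HM.
  - assert (Hs : is_series u l) by exact Hl.
    split; [now exists l|].
    rewrite (is_series_unique u l Hs).
    exact (is_lim_seq_le (sum_n u) (fun _ => M) l M HM Hl (is_lim_seq_const M)).
Qed.

Lemma coef_le_norm (r : R) (a : fps) (k : nat) :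
  0 <= r -> in_A r a -> Rabs (a k) * r ^ k <= norm_A r a.
Proof.
  intros Hr Ha.
  apply Rle_trans with (sum_n (fun j => Rabs (a j) * r ^ j) k).
  - destruct k as [|k]; [rewrite sum_O; lra|].
    rewrite sum_Sn.
    assert (H : 0 <= sum_n (fun j => Rabs (a j) * r ^ j) k).
    { rewrite sum_n_Reals. apply cond_pos_sum.
      intro j; now apply weight_nonneg. }
    unfold plus; simpl; simpl in H; lra.
  - apply sum_n_le_Series; [intro j; now apply weight_nonneg | exact Ha].
Qed.

Lemma norm_A_nonneg (r : R) (a : fps) : 0 <= r -> in_A r a -> 0 <= norm_A r a.
Proof.
  intros Hr Ha.
  apply Rle_trans with (2 := coef_le_norm r a 0 Hr Ha); now apply weight_nonneg.
Qed.

Lemma in_A_lin (r x y : R) (a b : fps) :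
  0 <= r -> in_A r a -> in_A r b ->
  in_A r (fun k => x * a k + y * b k) /\
  norm_A r (fun k => x * a k + y * b k) <= Rabs x * norm_A r a + Rabs y * norm_A r b.
Proof.
  intros Hr Ha Hb.
  set (m := fun k => Rabs x * (Rabs (a k) * r ^ k) + Rabs y * (Rabs (b k) * r ^ k)).
  assert (Ea : ex_series (fun k => Rabs x * (Rabs (a k) * r ^ k)))
    by exact (ex_series_scal (V := R_NormedModule) (Rabs x) _ Ha).
  assert (Eb : ex_series (fun k => Rabs y * (Rabs (b k) * r ^ k)))
    by exact (ex_series_scal (V := R_NormedModule) (Rabs y) _ Hb).
  assert (Em : ex_series m) by exact (ex_series_plus (V := R_NormedModule) _ _ Ea Eb).
  assert (Hle : forall k, 0 <= Rabs (x * a k + y * b k) * r ^ k <= m k).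
  { intro k; split; [now apply weight_nonneg|].
    unfold m; rewrite <- !Rmult_assoc, <- Rmult_plus_distr_r, <- !Rabs_mult.
    apply Rmult_le_compat_r; [now apply pow_le | apply Rabs_triang]. }
  split.
  - apply (ex_series_le (K := R_AbsRing) (V := R_CompleteNormedModule)) with (2 := Em).
    intro k; unfold norm; simpl; unfold abs; simpl.
    rewrite Rabs_pos_eq; apply Hle.
  - apply Rle_trans with (Series m); [now apply Series_le|].
    unfold m, norm_A.
    rewrite Series_plus, !Series_scal_l by assumption; lra.
Qed.

(** Differences and multiples are rewritten as two-term linear combinations, the
    one form in which the norm, the product, evaluation and [Phi] are each shown
    to be linear. *)
Lemma PS_minus_lin (a b : fps) : PS_minus a b = (fun k => 1 * a k + (-1) * b k).
Proof.
  apply functional_extensionality; intro k.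
  unfold PS_minus, plus, opp; simpl; ring.
Qed.

Lemma PS_scal_lin (x : R) (a : fps) : PS_scal x a = (fun k => x * a k + 0 * a k).
Proof.
  apply functional_extensionality; intro k.
  unfold PS_scal, scal; simpl; unfold mult; simpl; ring.
Qed.

(** The final [change] replaces the carrier of the normed module by [R], where
    [ring] and [field] find their structure. *)
Ltac fps_ext k :=
  apply functional_extensionality; intro k;
  rewrite ?PS_minus_lin, ?PS_scal_lin, ?PS_minus_lin, ?PS_scal_lin;
  match goal with |- ?x = ?y => change (@eq R x y) end.

Lemma in_A_minus (r : R) (a b : fps) :
  0 <= r -> in_A r a -> in_A r b -> in_A r (PS_minus a b).
Proof. intros Hr Ha Hb; rewrite PS_minus_lin; now apply in_A_lin. Qed.

Lemma in_A_scal (r x : R) (a : fps) : 0 <= r -> in_A r a -> in_A r (PS_scal x a).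
Proof. intros Hr Ha; rewrite PS_scal_lin; now apply in_A_lin. Qed.

Lemma norm_A_minus (r : R) (a b : fps) :
  0 <= r -> in_A r a -> in_A r b ->
  norm_A r (PS_minus a b) <= norm_A r a + norm_A r b.
Proof.
  intros Hr Ha Hb; rewrite PS_minus_lin.
  destruct (in_A_lin r 1 (-1) a b Hr Ha Hb) as [_ H].
  rewrite Rabs_R1, Rabs_left in H by lra; lra.
Qed.

Lemma norm_A_scal (r x : R) (a : fps) :
  norm_A r (PS_scal x a) = Rabs x * norm_A r a.
Proof.
  unfold norm_A; rewrite <- Series_scal_l; apply Series_ext; intro k.
  unfold PS_scal, scal; simpl; unfold mult; simpl; rewrite Rabs_mult; ring.
Qed.

Lemma norm_A_minus_triangle (r : R) (a b c : fps) :
  0 <= r -> in_A r (PS_minus a b) -> in_A r (PS_minus b c) ->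
  norm_A r (PS_minus a c) <= norm_A r (PS_minus a b) + norm_A r (PS_minus b c).
Proof.
  intros Hr H1 H2.
  replace (PS_minus a c)
    with (fun k => 1 * PS_minus a b k + 1 * PS_minus b c k).
  - destruct (in_A_lin r 1 1 _ _ Hr H1 H2) as [_ H].
    rewrite !Rabs_R1, !Rmult_1_l in H; exact H.
  - apply functional_extensionality; intro k; rewrite !PS_minus_lin; ring.
Qed.

Lemma norm_A_minus_sym (r : R) (a b : fps) :
  norm_A r (PS_minus a b) = norm_A r (PS_minus b a).
Proof.
  apply Series_ext; intro k; rewrite !PS_minus_lin, <- Rabs_Ropp.
  f_equal; f_equal; ring.
Qed.

Lemma norm_A_minus_eq0 (r : R) (a b : fps) :
  0 < r -> in_A r (PS_minus a b) -> norm_A r (PS_minus a b) <= 0 -> a = b.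
Proof.
  intros Hr Hin H0; apply functional_extensionality; intro k.
  assert (Hk := coef_le_norm r _ k (Rlt_le _ _ Hr) Hin).
  assert (Hp := pow_lt r k Hr).
  assert (Hz : Rabs (PS_minus a b k) = 0).
  { apply Rle_antisym; [|apply Rabs_pos].
    apply Rmult_le_reg_r with (r ^ k); lra. }
  apply Rabs_eq_0 in Hz; rewrite PS_minus_lin in Hz; lra.
Qed.

(** Fatou's lemma for the weighted norm: each finite partial sum passes to the
    limit, and the bound on it is uniform in the truncation. *)
Lemma in_A_of_pointwise_limit (r M : R) (d : nat -> fps) (a : fps) :
  0 <= r -> (forall n, in_A r (d n)) -> (forall n, norm_A r (d n) <= M) ->
  (forall k, is_lim_seq (fun n => d n k) (a k)) ->
  in_A r a /\ norm_A r a <= M.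
Proof.
  intros Hr Hd HM Hlim.
  apply ex_series_of_bounded; [intro k; now apply weight_nonneg|].
  intro K.
  assert (HK : is_lim_seq (fun n => sum_n (fun k => Rabs (d n k) * r ^ k) K)
                 (sum_n (fun k => Rabs (a k) * r ^ k) K)).
  { assert (Hk : forall k, is_lim_seq (fun n => Rabs (d n k) * r ^ k)
                             (Rabs (a k) * r ^ k)).
    { intro k; exact (is_lim_seq_scal_r _ (r ^ k) _ (is_lim_seq_abs _ _ (Hlim k))). }
    induction K as [|K IH].
    - rewrite sum_O; apply is_lim_seq_ext with (2 := Hk 0%nat).
      intro n; now rewrite sum_O.
    - rewrite sum_Sn; apply is_lim_seq_ext with (2 := is_lim_seq_plus' _ _ _ _ IH (Hk (S K))).
      intro n; now rewrite sum_Sn. }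
  apply (is_lim_seq_le _ (fun _ => M) _ M) with (2 := HK) (3 := is_lim_seq_const M).
  intro n; apply Rle_trans with (2 := HM n).
  apply sum_n_le_Series; [intro k; now apply weight_nonneg | apply Hd].
Qed.

(** The form of completeness of [in_A r] that is needed.  Each coefficient
    converges, being a telescoping sum dominated by a geometric series; the
    geometric tail bounds the distances within the sequence, and
    [in_A_of_pointwise_limit] transports that bound to the limit. *)
Lemma geometric_cauchy_limit (r C rho : R) (d : nat -> fps) :
  0 < r -> 0 <= rho < 1 -> (forall n, in_A r (d n)) ->
  (forall n, norm_A r (PS_minus (d (S n)) (d n)) <= C * rho ^ n) ->
  exists a, in_A r a /\
    forall n, norm_A r (PS_minus a (d n)) <= C * rho ^ n / (1 - rho).
Proof.
  intros Hr Hrho Hd Hstep.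
  assert (Hr0 : 0 <= r) by lra.
  assert (HC : 0 <= C).
  { specialize (Hstep 0%nat); simpl in Hstep.
    assert (H := norm_A_nonneg r _ Hr0 (in_A_minus _ _ _ Hr0 (Hd 1%nat) (Hd 0%nat))); lra. }
  assert (Hdist : forall n m,
    norm_A r (PS_minus (d (m + n)%nat) (d n)) <= C * rho ^ n / (1 - rho)).
  { intros n m.
    apply Rle_trans with (C * rho ^ n * (1 - rho ^ m) / (1 - rho)).
    - induction m as [|m IH]; simpl.
      + unfold norm_A; rewrite (Series_ext _ (fun k => 0 * 0)).
        * rewrite Series_scal_l; apply Req_le; field; lra.
        * intro k; rewrite PS_minus_lin.
          replace (1 * d n k + -1 * d n k) with 0 by ring; rewrite Rabs_R0; ring.
      + apply Rle_trans with (1 := norm_A_minus_triangle r _ (d (m + n)%nat) _ Hr0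
          (in_A_minus _ _ _ Hr0 (Hd _) (Hd _)) (in_A_minus _ _ _ Hr0 (Hd _) (Hd _))).
        apply Rle_trans with (1 := Rplus_le_compat _ _ _ _ (Hstep _) IH).
        apply Req_le; rewrite pow_add; field; lra.
    - apply Rmult_le_compat_r; [left; apply Rinv_0_lt_compat; lra|].
      rewrite <- (Rmult_1_r (C * rho ^ n)) at 2.
      apply Rmult_le_compat_l; [apply Rmult_le_pos; [lra | apply pow_le; lra]|].
      assert (0 <= rho ^ m) by (apply pow_le; lra); lra. }
  assert (Hcoef : forall k, exists l : R, is_lim_seq (fun n => d n k) l).
  { intro k.
    assert (Hp := pow_lt r k Hr).
    (* Telescoping: the limit is the sum of the increments plus the first term. *)
    assert (Hs : ex_series (fun n => d (S n) k - d n k)).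
    { apply (ex_series_le (K := R_AbsRing) (V := R_CompleteNormedModule))
        with (b := fun n => (C / r ^ k) * rho ^ n).
      - intro n; unfold norm; simpl; unfold abs; simpl.
        apply Rmult_le_reg_r with (r ^ k); [exact Hp|].
        replace (C / r ^ k * rho ^ n * r ^ k) with (C * rho ^ n) by (field; lra).
        apply Rle_trans with (2 := Hstep n).
        change (d (S n) k - d n k) with (PS_minus (d (S n)) (d n) k).
        apply coef_le_norm; [exact Hr0 | now apply in_A_minus].
      - apply (ex_series_scal (V := R_NormedModule) (C / r ^ k)).
        apply ex_series_geom; rewrite Rabs_pos_eq; lra. }
    destruct Hs as [l Hl].
    exists (l + d 0%nat k).
    apply is_lim_seq_incr_1.
    apply is_lim_seq_ext
      with (2 := is_lim_seq_plus' _ _ _ _ Hl (is_lim_seq_const (d 0%nat k))).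
    intro n; induction n as [|n IH]; [rewrite sum_O; ring|].
    rewrite sum_Sn, <- IH; unfold plus; simpl; ring. }
  set (a := fun k => real (Lim_seq (fun n => d n k))).
  assert (Ha : forall k, is_lim_seq (fun n => d n k) (a k)).
  { intro k; destruct (Hcoef k) as [l Hl].
    unfold a; rewrite (is_lim_seq_unique _ _ Hl); exact Hl. }
  assert (Hlim : forall n, in_A r (PS_minus a (d n)) /\
     norm_A r (PS_minus a (d n)) <= C * rho ^ n / (1 - rho)).
  { intro n.
    apply in_A_of_pointwise_limit
      with (d := fun m => PS_minus (d (m + n)%nat) (d n)).
    - exact Hr0.
    - intro m; now apply in_A_minus.
    - intro m; apply Hdist.
    - intro k; rewrite PS_minus_lin.
      apply is_lim_seq_ext with (fun m => d (m + n)%nat k + -1 * d n k).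
      + intro m; rewrite PS_minus_lin; ring.
      + rewrite Rmult_1_l; apply is_lim_seq_plus'; [|apply is_lim_seq_const].
        apply (is_lim_seq_incr_n (fun m => d m k) n), Ha. }
  exists a; split; [|intro n; apply Hlim].
  replace a with (fun k => 1 * PS_minus a (d 0%nat) k + 1 * d 0%nat k).
  - apply in_A_lin; [exact Hr0 | apply Hlim | apply Hd].
  - apply functional_extensionality; intro k; rewrite PS_minus_lin; ring.
Qed.

(** * The Cauchy product *)

Lemma PS_mult_lin_r (x y : R) (a b c : fps) :
  PS_mult a (fun k => x * b k + y * c k) =
  (fun k => x * PS_mult a b k + y * PS_mult a c k).
Proof.
  apply functional_extensionality; intro n; unfold PS_mult.
  rewrite !scal_sum, <- plus_sum; apply sum_eq; intros; ring.
Qed.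

Lemma PS_mult_lin_l (x y : R) (a b c : fps) :
  PS_mult (fun k => x * a k + y * b k) c =
  (fun k => x * PS_mult a c k + y * PS_mult b c k).
Proof.
  apply functional_extensionality; intro n; unfold PS_mult.
  rewrite !scal_sum, <- plus_sum; apply sum_eq; intros; ring.
Qed.

Lemma PS_mult_one_r (a : fps) : PS_mult a fps_one = a.
Proof.
  apply functional_extensionality; intro n; unfold PS_mult.
  destruct n as [|n]; simpl; [ring|].
  rewrite sum_eq_R0.
  - rewrite Nat.sub_diag; simpl; ring.
  - intros i Hi; destruct i as [|i]; simpl; [ring|].
    replace (n - i)%nat with (S (n - S i)) by lia; simpl; ring.
Qed.

Lemma PS_mult_one_l (a : fps) : PS_mult fps_one a = a.
Proof.
  apply functional_extensionality; intro n; unfold PS_mult.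
  assert (H : forall (f : nat -> R) m, sum_f_R0 (fun i => fps_one i * f i) m = f 0%nat).
  { intros f m; induction m as [|m IH]; simpl; [ring | rewrite IH; ring]. }
  rewrite (H (fun i => a (n - i)%nat)); f_equal; lia.
Qed.

(** The identity [(q - 1)^2 = (q^2 - 1) - 2 (q - 1)], through which the semigroup
    law is used. *)
Lemma PS_mult_minus_one (q : fps) :
  PS_mult (PS_minus q fps_one) (PS_minus q fps_one) =
  PS_minus (PS_minus (PS_mult q q) fps_one) (PS_scal 2 (PS_minus q fps_one)).
Proof.
  rewrite (PS_minus_lin q), PS_mult_lin_l, !PS_mult_lin_r, PS_mult_one_l, PS_mult_one_r.
  rewrite PS_mult_one_l.
  apply functional_extensionality; intro k.
  rewrite !PS_minus_lin, PS_scal_lin; ring.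
Qed.

(** Submultiplicativity: since the weight [r ^ k] is multiplicative, the weighted
    absolute values of a Cauchy product are dominated by the Cauchy product of
    the weighted absolute values, whose sum is the product of the norms. *)
Lemma in_A_mult (r : R) (a b : fps) :
  0 <= r -> in_A r a -> in_A r b ->
  in_A r (PS_mult a b) /\ norm_A r (PS_mult a b) <= norm_A r a * norm_A r b.
Proof.
  intros Hr Ha Hb.
  set (u := fun k => Rabs (a k) * r ^ k); set (v := fun k => Rabs (b k) * r ^ k).
  assert (Hu : forall k, 0 <= u k) by (intro k; now apply weight_nonneg).
  assert (Hv : forall k, 0 <= v k) by (intro k; now apply weight_nonneg).
  assert (Hs : is_series (PS_mult u v) (norm_A r a * norm_A r b)).
  { apply is_series_mult.
    - exact (Series_correct _ Ha).
    - exact (Series_correct _ Hb).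
    - apply ex_series_ext with (2 := Ha); intro k; symmetry; apply Rabs_pos_eq, Hu.
    - apply ex_series_ext with (2 := Hb); intro k; symmetry; apply Rabs_pos_eq, Hv. }
  assert (Hle : forall k, 0 <= Rabs (PS_mult a b k) * r ^ k <= PS_mult u v k).
  { intro n; split; [now apply weight_nonneg|].
    unfold PS_mult.
    apply Rle_trans with
      (sum_f_R0 (fun k => Rabs (a k * b (n - k)%nat)) n * r ^ n).
    - apply Rmult_le_compat_r; [now apply pow_le | apply Rsum_abs].
    - rewrite Rmult_comm, scal_sum; apply Req_le, sum_eq; intros i Hi.
      unfold u, v; rewrite Rabs_mult.
      replace (r ^ n) with (r ^ i * r ^ (n - i)) by (rewrite <- pow_add; f_equal; lia).
      ring. }
  assert (Hex : ex_series (PS_mult u v)) by (eexists; exact Hs).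
  split.
  - apply (ex_series_le (K := R_AbsRing) (V := R_CompleteNormedModule)) with (2 := Hex).
    intro k; unfold norm; simpl; unfold abs; simpl.
    rewrite Rabs_pos_eq; apply Hle.
  - rewrite <- (is_series_unique _ _ Hs); now apply Series_le.
Qed.

(** * Evaluation on the disk *)

(** The real and imaginary parts of the value at [z] are the pairings of the
    coefficients with [Re (z ^ k)] and [Im (z ^ k)].  Both weights are bounded by
    [r ^ k], which is all that the continuity of evaluation requires, so the two
    parts are treated together through an arbitrary such weight [w]. *)
Lemma pairing_summable (r : R) (a w : fps) :
  in_A r a -> (forall k, Rabs (w k) <= r ^ k) ->
  ex_series (fun k => Rabs (a k * w k)).
Proof.
  intros Ha Hw.
  apply (ex_series_le (K := R_AbsRing) (V := R_CompleteNormedModule)) with (2 := Ha).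
  intro k; unfold norm; simpl; unfold abs; simpl.
  rewrite Rabs_Rabsolu, Rabs_mult.
  apply Rmult_le_compat_l; [apply Rabs_pos | apply Hw].
Qed.

Lemma pairing_dist (r : R) (a b w : fps) :
  0 <= r -> in_A r a -> in_A r b -> (forall k, Rabs (w k) <= r ^ k) ->
  Rabs (Series (fun k => a k * w k) - Series (fun k => b k * w k)) <=
  norm_A r (PS_minus a b).
Proof.
  intros Hr Ha Hb Hw.
  rewrite <- Series_minus by (apply ex_series_Rabs; now apply pairing_summable with r).
  assert (Hab := in_A_minus r a b Hr Ha Hb).
  rewrite (Series_ext _ (fun k => PS_minus a b k * w k))
    by (intro k; rewrite PS_minus_lin; ring).
  apply Rle_trans with (1 := Series_Rabs _ (pairing_summable r _ w Hab Hw)).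
  apply Series_le; [|exact Hab].
  intro k; split; [apply Rabs_pos|].
  rewrite Rabs_mult; apply Rmult_le_compat_l; [apply Rabs_pos | apply Hw].
Qed.

Lemma Re_pow_bound (r : R) (z : C) (k : nat) :
  Cmod z < r -> Rabs (Re (z ^ k)%C) <= r ^ k.
Proof.
  intro Hz; apply Rle_trans with (Cmod (z ^ k)%C).
  - exact (Rle_trans _ _ _ (Rmax_l _ _) (Rmax_Cmod (z ^ k)%C)).
  - rewrite Cmod_pow; apply pow_incr; split; [apply Cmod_ge_0 | lra].
Qed.

Lemma Im_pow_bound (r : R) (z : C) (k : nat) :
  Cmod z < r -> Rabs (Im (z ^ k)%C) <= r ^ k.
Proof.
  intro Hz; apply Rle_trans with (Cmod (z ^ k)%C).
  - exact (Rle_trans _ _ _ (Rmax_r _ _) (Rmax_Cmod (z ^ k)%C)).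
  - rewrite Cmod_pow; apply pow_incr; split; [apply Cmod_ge_0 | lra].
Qed.

(** Reduces complex evaluation to two real series, for which summation of
    Cauchy products and comparison are at hand. *)
Lemma fps_eval_Re_Im (r : R) (a : fps) (z : C) :
  in_A r a -> Cmod z < r ->
  fps_eval a z =
  (Series (fun k => a k * Re (z ^ k)%C), Series (fun k => a k * Im (z ^ k)%C)).
Proof.
  intros Ha Hz.
  assert (H := fps_eval_correct r a z Ha Hz).
  assert (Hpow : forall k, @pow_n C_AbsRing z k = (z ^ k)%C).
  { induction k as [|k IH]; simpl; [reflexivity | now rewrite <- IH]. }
  set (S := sum_n (fun k => scal (@pow_n C_AbsRing z k) (RtoC (a k) : C_NormedModule))).
  assert (Hlim : filterlim S eventually (locally (fps_eval a z))) by exact H.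
  assert (HS : forall n, S n = (sum_n (fun k => a k * Re (z ^ k)%C) n,
                                sum_n (fun k => a k * Im (z ^ k)%C) n)).
  { assert (Hterm : forall k, scal (@pow_n C_AbsRing z k) (RtoC (a k) : C_NormedModule)
              = (a k * Re (z ^ k)%C, a k * Im (z ^ k)%C)).
    { intro k; rewrite Hpow.
      change (Cmult (z ^ k)%C (RtoC (a k)) = (a k * Re (z ^ k)%C, a k * Im (z ^ k)%C)).
      unfold Cmult, RtoC, Re, Im; simpl; f_equal; ring. }
    intro n; unfold S; induction n as [|n IH].
    - rewrite !sum_O; apply Hterm.
    - rewrite !sum_Sn, IH, Hterm; reflexivity. }
  apply injective_projections; symmetry; apply is_series_unique.
  - apply filterlim_ext with (fun n => fst (S n)).
    + intro n; now rewrite HS.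
    + apply filterlim_comp with (1 := Hlim).
      destruct (fps_eval a z) as [x y].
      intros P [e He]; exists e; intros u Hu; apply He; apply Hu.
  - apply filterlim_ext with (fun n => snd (S n)).
    + intro n; now rewrite HS.
    + apply filterlim_comp with (1 := Hlim).
      destruct (fps_eval a z) as [x y].
      intros P [e He]; exists e; intros u Hu; apply He; apply Hu.
Qed.

Lemma fps_eval_lin (r x y : R) (a b : fps) (z : C) :
  0 <= r -> in_A r a -> in_A r b -> Cmod z < r ->
  fps_eval (fun k => x * a k + y * b k) z =
  (RtoC x * fps_eval a z + RtoC y * fps_eval b z)%C.
Proof.
  intros Hr Ha Hb Hz.
  destruct (in_A_lin r x y a b Hr Ha Hb) as [Hab _].
  rewrite !(fps_eval_Re_Im r) by assumption.
  assert (Hlin : forall w, (forall k, Rabs (w k) <= r ^ k) ->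
    Series (fun k => (x * a k + y * b k) * w k) =
    x * Series (fun k => a k * w k) + y * Series (fun k => b k * w k)).
  { intros w Hw; rewrite <- !Series_scal_l, <- Series_plus.
    - apply Series_ext; intro k; ring.
    - apply (ex_series_scal (V := R_NormedModule) x), ex_series_Rabs.
      now apply pairing_summable with r.
    - apply (ex_series_scal (V := R_NormedModule) y), ex_series_Rabs.
      now apply pairing_summable with r. }
  rewrite !Hlin by (intro k; (now apply Re_pow_bound) || (now apply Im_pow_bound)).
  unfold Cmult, Cplus, RtoC; simpl; f_equal; ring.
Qed.

Lemma is_series_one (w : fps) : is_series (fun k => fps_one k * w k) (w 0%nat).
Proof.
  apply filterlim_ext with (fun _ : nat => w 0%nat); [|apply filterlim_const].
  intro n; induction n as [|n IH].
  - rewrite sum_O; simpl; ring.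
  - rewrite sum_Sn, <- IH; unfold plus; simpl; ring.
Qed.

Lemma in_A_one (r : R) : in_A r fps_one.
Proof.
  exists (r ^ 0); apply is_series_ext with (2 := is_series_one (fun k => r ^ k)).
  intros [|k]; simpl; [rewrite Rabs_R1 | rewrite Rabs_R0]; reflexivity.
Qed.

Lemma fps_eval_one (z : C) : fps_eval fps_one z = RtoC 1.
Proof.
  assert (Hz : Cmod z < Cmod z + 1) by lra.
  rewrite (fps_eval_Re_Im _ _ _ (in_A_one _) Hz).
  now rewrite !(is_series_unique _ _ (is_series_one _)).
Qed.

(** Expanding [z ^ n = z ^ i * z ^ (n - i)] into real and imaginary parts turns
    the claim into four applications of the real theorem on Cauchy products. *)
Lemma fps_eval_mult (r : R) (a b : fps) (z : C) :
  0 <= r -> in_A r a -> in_A r b -> Cmod z < r ->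
  fps_eval (PS_mult a b) z = (fps_eval a z * fps_eval b z)%C.
Proof.
  intros Hr Ha Hb Hz.
  destruct (in_A_mult r a b Hr Ha Hb) as [Hab _].
  rewrite !(fps_eval_Re_Im r) by assumption.
  assert (Hre : forall k, Rabs (Re (z ^ k)%C) <= r ^ k) by (intro; now apply Re_pow_bound).
  assert (Him : forall k, Rabs (Im (z ^ k)%C) <= r ^ k) by (intro; now apply Im_pow_bound).
  assert (Hcauchy : forall v w,
    (forall k, Rabs (v k) <= r ^ k) -> (forall k, Rabs (w k) <= r ^ k) ->
    is_series (PS_mult (fun k => a k * v k) (fun k => b k * w k))
      (Series (fun k => a k * v k) * Series (fun k => b k * w k))).
  { intros v w Hv Hw; apply is_series_mult.
    - apply Series_correct, ex_series_Rabs; now apply pairing_summable with r.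
    - apply Series_correct, ex_series_Rabs; now apply pairing_summable with r.
    - now apply pairing_summable with r.
    - now apply pairing_summable with r. }
  assert (Hsplit : forall i n, (i <= n)%nat -> (z ^ n)%C = (z ^ i * z ^ (n - i))%C).
  { intros i n Hi; rewrite <- Cpow_add_r; f_equal; lia. }
  apply injective_projections; simpl; apply is_series_unique.
  - apply is_series_ext with
      (2 := is_series_minus (V := R_NormedModule) _ _ _ _
              (Hcauchy _ _ Hre Hre) (Hcauchy _ _ Him Him)).
    intro n; unfold PS_mult, plus, opp; simpl.
    rewrite (Rmult_comm (sum_f_R0 _ n) (Re _)), scal_sum.
    etransitivity; [symmetry; apply minus_sum|]; apply sum_eq; intros i Hi.
    rewrite (Hsplit i n Hi); unfold Cmult, Re, Im; simpl; ring.
  - apply is_series_ext with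
      (2 := is_series_plus (V := R_NormedModule) _ _ _ _
              (Hcauchy _ _ Hre Him) (Hcauchy _ _ Him Hre)).
    intro n; unfold PS_mult, plus; simpl.
    rewrite (Rmult_comm (sum_f_R0 _ n) (Im _)), scal_sum.
    rewrite <- plus_sum; apply sum_eq; intros i Hi.
    rewrite (Hsplit i n Hi); unfold Cmult, Re, Im; simpl; ring.
Qed.

(** Real arguments suffice: there the value is the sum of a real power series
    with positive radius of convergence, which determines its coefficients. *)
Lemma fps_eval_inj (r : R) (a b : fps) :
  0 < r -> in_A r a -> in_A r b ->
  (forall z, Cmod z < r -> fps_eval a z = fps_eval b z) -> a = b.
Proof.
  intros Hr Ha Hb Hab.
  assert (Hcv : forall c, in_A r c -> Rbar_lt 0 (CV_radius c)).
  { intros c Hc; apply Rbar_lt_le_trans with r; [exact Hr|].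
    apply CV_radius_bounded; exists (norm_A r c); intro n.
    rewrite Rabs_mult, (Rabs_pos_eq (r ^ n)) by (apply pow_le; lra).
    apply coef_le_norm; [lra | exact Hc]. }
  assert (Hreal : forall c x, in_A r c -> Rabs x < r ->
    Re (fps_eval c (RtoC x)) = PSeries c x).
  { intros c x Hc Hx; rewrite (fps_eval_Re_Im r) by (assumption || now rewrite Cmod_R).
    apply Series_ext; intro k; now rewrite <- RtoC_pow. }
  apply functional_extensionality; intro n.
  apply PSeries_ext_recip; [now apply Hcv | now apply Hcv|].
  exists (mkposreal r Hr); intros x Hx.
  assert (Hxr : Rabs x < r).
  { change (Rabs (x - 0) < r) in Hx; now rewrite Rminus_0_r in Hx. }
  rewrite <- !Hreal by assumption.
  rewrite Hab; [reflexivity | now rewrite Cmod_R].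
Qed.

Lemma fps_eval_continuous (r : R) (d : nat -> fps) (a : fps) (z : C) :
  0 <= r -> in_A r a -> (forall n, in_A r (d n)) -> Cmod z < r ->
  is_lim_seq (fun n => norm_A r (PS_minus a (d n))) 0 ->
  filterlim (fun n => fps_eval (d n) z) eventually (locally (fps_eval a z)).
Proof.
  intros Hr Ha Hd Hz Hlim; apply filterlim_locally; intro eps.
  assert (Hev := proj1 (filterlim_locally _ _) Hlim eps).
  apply filter_imp with (2 := Hev); intros n Hn.
  change (Rabs (norm_A r (PS_minus a (d n)) - 0) < eps) in Hn.
  rewrite Rminus_0_r in Hn; apply Rabs_lt_between in Hn.
  rewrite !(fps_eval_Re_Im r) by auto.
  split.
  - change (Rabs (Series (fun k => d n k * Re (z ^ k)%C) -
                  Series (fun k => a k * Re (z ^ k)%C)) < eps).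
    rewrite Rabs_minus_sym; apply Rle_lt_trans with (2 := proj2 Hn).
    apply pairing_dist; auto; intro k; now apply Re_pow_bound.
  - change (Rabs (Series (fun k => d n k * Im (z ^ k)%C) -
                  Series (fun k => a k * Im (z ^ k)%C)) < eps).
    rewrite Rabs_minus_sym; apply Rle_lt_trans with (2 := proj2 Hn).
    apply pairing_dist; auto; intro k; now apply Im_pow_bound.
Qed.

(** * Differentiability at 0 by repeated halving *)

Lemma dyadic_at_right (s : R) :
  0 < s -> filterlim (fun n => s / 2 ^ n) eventually (at_right 0).
Proof.
  intros Hs P [e He].
  assert (Hlim : is_lim_seq (fun n => s * (/ 2) ^ n) 0).
  { rewrite <- (Rmult_0_r s).
    apply (is_lim_seq_scal_l _ s (Finite 0)), is_lim_seq_geom; rewrite Rabs_pos_eq; lra. }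
  assert (Hball := Hlim _ (locally_ball (0 : R_UniformSpace) e)).
  unfold filtermap in *; apply filter_imp with (2 := Hball).
  intros n Hn; apply He.
  - unfold Rdiv; now rewrite <- pow_inv.
  - apply Rdiv_lt_0_compat; [exact Hs | apply pow_lt; lra].
Qed.

(** Here [u s] stands for [q s - 1]; the doubling hypothesis is all that is kept
    of the semigroup law.  The bound [1/8] is what the absorption step in
    [generator_of_halving] needs; halving alone would allow [1/2]. *)
Section Halving.

Variables (r delta : R) (u : R -> fps).
Hypothesis Hr : 0 < r.
Hypothesis Hu : forall s, 0 <= s -> in_A r (u s).
Hypothesis Hdouble : forall s, 0 <= s ->
  PS_mult (u s) (u s) = PS_minus (u (s + s)) (PS_scal 2 (u s)).
Hypothesis Hsmall : forall s, 0 < s < delta -> norm_A r (u s) <= 1 / 8.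

(** From [2 u h = u (2h) - (u h)^2]: the square is absorbed in the left side,
    since [|u h|^2 <= |u h| / 8]. *)
Lemma norm_halving (s : R) :
  0 < s < delta -> norm_A r (u (s / 2)) <= 2 / 3 * norm_A r (u s).
Proof.
  intros Hs.
  assert (Hr0 : 0 <= r) by lra.
  assert (Hh : in_A r (u (s / 2))) by (apply Hu; lra).
  destruct (in_A_mult r _ _ Hr0 Hh Hh) as [Hm Hmn].
  assert (Hn := norm_A_minus r _ _ Hr0 (Hu s (Rlt_le _ _ (proj1 Hs))) Hm).
  rewrite (Hdouble (s / 2)) in Hn by lra.
  replace (s / 2 + s / 2) with s in Hn by field.
  replace (PS_minus (u s) (PS_minus (u s) (PS_scal 2 (u (s / 2)))))
    with (PS_scal 2 (u (s / 2))) in Hn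
    by (fps_ext k; ring).
  rewrite norm_A_scal, Rabs_pos_eq in Hn by lra.
  rewrite (Hdouble (s / 2)) in Hmn by lra.
  replace (s / 2 + s / 2) with s in Hmn by field.
  assert (H8 := Hsmall (s / 2) ltac:(lra)).
  assert (Hpos := norm_A_nonneg r _ Hr0 Hh).
  nra.
Qed.

Lemma norm_dyadic (s : R) (n : nat) :
  0 < s < delta -> norm_A r (u (s / 2 ^ n)) <= (2 / 3) ^ n * norm_A r (u s).
Proof.
  intros Hs; induction n as [|n IH].
  - simpl; rewrite Rdiv_1_r; lra.
  - assert (Hp : 1 <= 2 ^ n) by (apply pow_R1_Rle; lra).
    replace (s / 2 ^ S n) with (s / 2 ^ n / 2) by (simpl; field; lra).
    apply Rle_trans with (2 / 3 * norm_A r (u (s / 2 ^ n))).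
    + apply norm_halving; split; [apply Rdiv_lt_0_compat; lra|].
      apply Rle_lt_trans with (2 := proj2 Hs).
      apply Rle_div_l; [lra | nra].
    + simpl; lra.
Qed.

(** Consecutive terms differ by exactly [2^n (u h)^2] with [h = s / 2^(n+1)].
    Two powers of [2/3] from [norm_dyadic] beat the factor [2^n], the ratio
    being [2 * (2/3)^2 = 8/9].  The limit is the logarithm of [1 + u s]. *)
Lemma dyadic_limit (s : R) :
  0 < s < delta ->
  exists L, in_A r L /\ forall n,
    norm_A r (PS_minus L (PS_scal (2 ^ n) (u (s / 2 ^ n)))) <=
    4 * norm_A r (u s) ^ 2 * (8 / 9) ^ n.
Proof.
  intros Hs.
  assert (Hr0 : 0 <= r) by lra.
  assert (Hh : forall n, 0 < s / 2 ^ n)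
    by (intro n; apply Rdiv_lt_0_compat; [lra | apply pow_lt; lra]).
  assert (Hin : forall n, in_A r (u (s / 2 ^ n))) by (intro n; apply Hu, Rlt_le, Hh).
  destruct (geometric_cauchy_limit r (4 / 9 * norm_A r (u s) ^ 2) (8 / 9)
    (fun n => PS_scal (2 ^ n) (u (s / 2 ^ n)))) as [L [HL Hd]].
  - exact Hr.
  - lra.
  - intro n; now apply in_A_scal.
  - intro n.
    set (h := s / 2 ^ S n).
    assert (Hp : 0 < 2 ^ n) by (apply pow_lt; lra).
    replace (s / 2 ^ n) with (h + h) by (unfold h; simpl; field; lra).
    rewrite norm_A_minus_sym.
    replace (PS_minus (PS_scal (2 ^ n) (u (h + h))) (PS_scal (2 ^ S n) (u h)))
      with (PS_scal (2 ^ n) (PS_mult (u h) (u h))).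
    + rewrite norm_A_scal, Rabs_pos_eq by lra.
      destruct (in_A_mult r _ _ Hr0 (Hin (S n)) (Hin (S n))) as [_ Hmn].
      assert (Hn := norm_dyadic s (S n) Hs).
      assert (H0 := norm_A_nonneg r _ Hr0 (Hin (S n))).
      fold h in Hmn, Hn, H0.
      apply Rle_trans with (2 ^ n * ((2 / 3) ^ S n * norm_A r (u s)) ^ 2).
      * apply Rmult_le_compat_l; [lra|].
        apply Rle_trans with (1 := Hmn); nra.
      * apply Req_le.
        replace (8 / 9) with (2 * (2 / 3 * (2 / 3))) by field.
        rewrite !Rpow_mult_distr; simpl; field.
    + rewrite (Hdouble h) by (apply Rlt_le, Hh).
      fps_ext k; simpl; ring.
  - exists L; split; [exact HL|].
    intro n; apply Rle_trans with (1 := Hd n); apply Req_le; field.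
Qed.

Variable eta : C -> C.
Hypothesis Heta : forall z, Cmod z < r ->
  filterlim (fun s : R => (fps_eval (u s) z / RtoC s)%C) (at_right 0) (locally (eta z)).

(** With [h = s / 2^n], the value of [2^n u h] is [s] times the difference quotient
    [u h / h], so the assumed derivative at 0 computes the limit; this is where
    the dependence of the logarithm on [s] is seen to be linear. *)
Lemma dyadic_limit_eval (s : R) (L : fps) (z : C) :
  0 < s -> in_A r L ->
  is_lim_seq (fun n => norm_A r (PS_minus L (PS_scal (2 ^ n) (u (s / 2 ^ n))))) 0 ->
  Cmod z < r -> fps_eval L z = (RtoC s * eta z)%C.
Proof.
  intros Hs HL Hlim Hz.
  assert (Hr0 : 0 <= r) by lra.
  assert (Hh : forall n, 0 < s / 2 ^ n)
    by (intro n; apply Rdiv_lt_0_compat; [lra | apply pow_lt; lra]).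
  assert (Hin : forall n, in_A r (u (s / 2 ^ n))) by (intro n; apply Hu, Rlt_le, Hh).
  assert (H1 := fps_eval_continuous r (fun n => PS_scal (2 ^ n) (u (s / 2 ^ n))) L z
    Hr0 HL (fun n => in_A_scal r _ _ Hr0 (Hin n)) Hz Hlim).
  assert (H2 := filterlim_comp _ _ _ _ _ _ _ _ (dyadic_at_right s Hs) (Heta z Hz)).
  assert (H3 := filterlim_comp _ _ _ _ _ _ _ _ H2
    (filterlim_scal_r (K := C_AbsRing) (V := C_NormedModule) (RtoC s) (eta z))).
  refine (filterlim_locally_unique (K := C_AbsRing) (V := C_NormedModule)
            (F := eventually) _ _ _ H1 _).
  refine (filterlim_ext _ _ _ H3); intro n.
  change ((RtoC s * (fps_eval (u (s / 2 ^ n)) z / RtoC (s / 2 ^ n)))%C =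
          fps_eval (PS_scal (2 ^ n) (u (s / 2 ^ n))) z).
  rewrite PS_scal_lin, (fps_eval_lin r) by auto.
  assert (Hp : 2 ^ n <> 0) by (apply pow_nonzero; lra).
  rewrite RtoC_div by exact Hp.
  field; split; intro H; apply RtoC_inj in H; lra.
Qed.

(** The derivative [g] is read off from the logarithm at a single point, and
    [fps_eval_inj] shows that [s g] is the logarithm at every other small [s]. *)
Lemma generator_of_halving :
  0 < delta ->
  filterlim (fun s => norm_A r (u s)) (at_right 0) (locally 0) ->
  exists g, in_A r g /\
    (forall z, Cmod z < r -> fps_eval g z = eta z) /\
    filterlim (fun s => norm_A r (PS_minus (PS_scal (/ s) (u s)) g))
      (at_right 0) (locally 0).
Proof.
  intros Hdelta Hcont.
  assert (Hr0 : 0 <= r) by lra.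
  assert (Hlog : forall s, 0 < s < delta -> exists L, in_A r L /\
     (forall z, Cmod z < r -> fps_eval L z = (RtoC s * eta z)%C) /\
     norm_A r (PS_minus L (u s)) <= 4 * norm_A r (u s) ^ 2).
  { intros s Hs; destruct (dyadic_limit s Hs) as [L [HL Hd]].
    exists L; split; [exact HL|]; split.
    - intros z Hz; apply dyadic_limit_eval; [apply Hs | exact HL | | exact Hz].
      apply is_lim_seq_le_le with (u := fun _ => 0) (2 := is_lim_seq_const 0)
        (w := fun n => 4 * norm_A r (u s) ^ 2 * (8 / 9) ^ n).
      + intro n; split; [|apply Hd].
        apply norm_A_nonneg; [exact Hr0|].
        apply in_A_minus; [exact Hr0 | exact HL | apply in_A_scal; [exact Hr0|]].
        apply Hu, Rlt_le, Rdiv_lt_0_compat; [lra | apply pow_lt; lra].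
      + rewrite <- (Rmult_0_r (4 * norm_A r (u s) ^ 2)).
        apply (is_lim_seq_scal_l _ _ (Finite 0)), is_lim_seq_geom.
        rewrite Rabs_pos_eq; lra.
    - specialize (Hd 0%nat); simpl in Hd; rewrite Rdiv_1_r in Hd.
      replace (PS_scal 1 (u s)) with (u s) in Hd; [simpl; lra|].
      fps_ext k; ring. }
  destruct (Hlog (delta / 2) ltac:(lra)) as [L0 [HL0 [Hev0 _]]].
  set (g := PS_scal (/ (delta / 2)) L0).
  assert (Hg : in_A r g) by now apply in_A_scal.
  assert (Hgev : forall z, Cmod z < r -> fps_eval g z = eta z).
  { intros z Hz; unfold g.
    rewrite PS_scal_lin, (fps_eval_lin r), Hev0, RtoC_inv by (auto; lra).
    field; intro H; apply RtoC_inj in H; lra. }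
  assert (Hquad : forall s, 0 < s < delta ->
     norm_A r (PS_minus (PS_scal s g) (u s)) <= 4 * norm_A r (u s) ^ 2).
  { intros s Hs; destruct (Hlog s Hs) as [L [HL [Hev Hd]]].
    replace (PS_scal s g) with L; [exact Hd|].
    apply fps_eval_inj with r; [exact Hr | exact HL | now apply in_A_scal|].
    intros z Hz; rewrite Hev, PS_scal_lin, (fps_eval_lin r), Hgev by auto; ring. }
  exists g; split; [exact Hg|]; split; [exact Hgev|].
  set (G := norm_A r g) in *.
  assert (HG : 0 <= G) by now apply norm_A_nonneg.
  assert (Hbound : forall s, 0 < s < delta ->
     norm_A r (PS_minus (PS_scal (/ s) (u s)) g) <= 8 * G * norm_A r (u s)).
  { intros s Hs.
    assert (Hus : in_A r (u s)) by (apply Hu; lra).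
    set (N := norm_A r (u s)) in *.
    assert (HN : 0 <= N) by now apply norm_A_nonneg.
    assert (HN8 : N <= 1 / 8) by now apply Hsmall.
    assert (Hq := Hquad s Hs); fold N in Hq.
    assert (Hdiff : in_A r (PS_minus (PS_scal s g) (u s))).
    { apply in_A_minus; [exact Hr0 | now apply in_A_scal | exact Hus]. }
    (* The quadratic term is at most N / 2, whence N is at most 2 s G. *)
    assert (HN1 : N <= s * G + 4 * N ^ 2).
    { assert (H := norm_A_minus r _ _ Hr0 (in_A_scal r s g Hr0 Hg) Hdiff).
      replace (PS_minus (PS_scal s g) (PS_minus (PS_scal s g) (u s)))
        with (u s) in H
        by (fps_ext k; ring).
      rewrite norm_A_scal, Rabs_pos_eq in H by lra.
      fold N G in H; lra. }
    assert (HN2 : N <= 2 * (s * G)) by nra.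
    replace (PS_minus (PS_scal (/ s) (u s)) g)
      with (PS_scal (- / s) (PS_minus (PS_scal s g) (u s))).
    - rewrite norm_A_scal, Rabs_Ropp, Rabs_pos_eq
        by (left; apply Rinv_0_lt_compat; lra).
      apply Rmult_le_reg_l with s; [lra|].
      rewrite <- Rmult_assoc, Rinv_r, Rmult_1_l by lra.
      apply Rle_trans with (1 := Hq); nra.
    - fps_ext k;
      field; lra. }
  apply filterlim_locally; intro eps.
  assert (He : 0 < eps / (8 * G + 1))
    by (apply Rdiv_lt_0_compat; [apply cond_pos | lra]).
  destruct (proj1 (filterlim_locally _ _) Hcont (mkposreal _ He)) as [e1 He1].
  assert (Hm : 0 < Rmin e1 delta) by (apply Rmin_pos; [apply cond_pos | exact Hdelta]).
  exists (mkposreal _ Hm); intros s Hball Hs.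
  assert (Hs2 : s < Rmin e1 delta).
  { change (Rabs (s - 0) < Rmin e1 delta) in Hball.
    rewrite Rminus_0_r, Rabs_pos_eq in Hball; lra. }
  assert (Hse : s < e1) by (apply Rlt_le_trans with (1 := Hs2); apply Rmin_l).
  assert (Hsd : s < delta) by (apply Rlt_le_trans with (1 := Hs2); apply Rmin_r).
  assert (Hus : in_A r (u s)) by (apply Hu; lra).
  assert (Hn0 := norm_A_nonneg r _ Hr0 Hus).
  assert (Hn : norm_A r (u s) < eps / (8 * G + 1)).
  { assert (H : ball 0 e1 s)
      by (change (Rabs (s - 0) < e1); rewrite Rminus_0_r, Rabs_pos_eq; lra).
    specialize (He1 s H Hs).
    change (Rabs (norm_A r (u s) - 0) < eps / (8 * G + 1)) in He1.
    rewrite Rminus_0_r, Rabs_pos_eq in He1; lra. }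
  change (Rabs (norm_A r (PS_minus (PS_scal (/ s) (u s)) g) - 0) < eps).
  rewrite Rminus_0_r, Rabs_pos_eq.
  - apply Rle_lt_trans with (1 := Hbound s (conj Hs Hsd)).
    apply Rlt_div_r in Hn; [nra | lra].
  - apply norm_A_nonneg; [exact Hr0|].
    apply in_A_minus; [exact Hr0 | now apply in_A_scal | exact Hg].
Qed.

End Halving.

(** * Passing through Phi, and the two operators as convolutions *)

Lemma norm_limit_unique (r : R) (F : (R -> Prop) -> Prop) (FF : ProperFilter F)
  (d : R -> fps) (a b : fps) :
  0 < r -> in_A r a -> in_A r b -> F (fun s => in_A r (d s)) ->
  filterlim (fun s => norm_A r (PS_minus (d s) a)) F (locally 0) ->
  filterlim (fun s => norm_A r (PS_minus (d s) b)) F (locally 0) ->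
  a = b.
Proof.
  intros Hr Ha Hb Hd H1 H2.
  assert (Hr0 : 0 <= r) by lra.
  assert (Hab : in_A r (PS_minus a b)) by now apply in_A_minus.
  apply norm_A_minus_eq0 with r; [exact Hr | exact Hab|].
  apply le_epsilon; intros e He.
  assert (He2 : 0 < e / 2) by lra.
  assert (E1 := proj1 (filterlim_locally _ _) H1 (mkposreal _ He2)).
  assert (E2 := proj1 (filterlim_locally _ _) H2 (mkposreal _ He2)).
  destruct (filter_ex _ (filter_and _ _ Hd (filter_and _ _ E1 E2))) as [s [Hs [D1 D2]]].
  change (Rabs (norm_A r (PS_minus (d s) a) - 0) < e / 2) in D1.
  change (Rabs (norm_A r (PS_minus (d s) b) - 0) < e / 2) in D2.
  rewrite Rminus_0_r in D1, D2; apply Rabs_lt_between in D1, D2.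
  rewrite norm_A_minus_sym in D1.
  assert (Ht := norm_A_minus_triangle r a (d s) b Hr0
    (in_A_minus _ _ _ Hr0 Ha Hs) (in_A_minus _ _ _ Hr0 Hs Hb)).
  lra.
Qed.

Lemma ffact_neq0 (t : R) (k : nat) : (forall n, t <> INR n) -> ffact t k <> 0.
Proof.
  intro Ht; induction k as [|k IH]; simpl; [lra|].
  apply Rmult_integral_contrapositive; split; [exact IH|].
  specialize (Ht k); lra.
Qed.

Lemma Phi_lin (t x y : R) (a b : fps) :
  Phi t (fun k => x * a k + y * b k) = (fun k => x * Phi t a k + y * Phi t b k).
Proof. apply functional_extensionality; intro k; unfold Phi, Rdiv; ring. Qed.

Lemma Phi_one (t : R) : Phi t fps_one = fps_one.
Proof.
  apply functional_extensionality; intros [|k]; unfold Phi, Rdiv; simpl;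
    [rewrite Rinv_1|]; ring.
Qed.

Lemma Phi_boxplus (t : R) (a b : fps) :
  (forall n, t <> INR n) -> Phi t (boxplus t a b) = PS_mult (Phi t a) (Phi t b).
Proof.
  intro Ht; apply functional_extensionality; intro n.
  unfold Phi, boxplus, PS_mult, Rdiv; rewrite Rmult_comm, scal_sum.
  apply sum_eq; intros i Hi; field; repeat split; now apply ffact_neq0.
Qed.

Lemma Phi_inv_Phi (t : R) (a : fps) :
  (forall n, t <> INR n) -> Phi_inv t (Phi t a) = a.
Proof.
  intro Ht; apply functional_extensionality; intro n; unfold Phi, Phi_inv.
  field; now apply ffact_neq0.
Qed.

Lemma Phi_Phi_inv (t : R) (a : fps) :
  (forall n, t <> INR n) -> Phi t (Phi_inv t a) = a.
Proof.
  intro Ht; apply functional_extensionality; intro n; unfold Phi, Phi_inv.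
  field; now apply ffact_neq0.
Qed.

(** A norm-continuous semigroup is norm-differentiable at 0, and its derivative
    is the power series of [eta]: in particular [eta] itself lies in [in_A r]. *)
Lemma semigroup_norm_derivative (t r : R) (Q : R -> fps) (eta : C -> C) :
  (forall n : nat, t <> INR n) -> 0 < r -> boxplus_semigroup t r Q ->
  (forall z : C, Cmod z < r ->
       filterlim
         (fun s : R => ((fps_eval (Phi t (Q s)) z - RtoC 1) / RtoC s)%C)
         (at_right 0) (locally (eta z))) ->
  exists g, in_A r g /\
    (forall z, Cmod z < r -> fps_eval g z = eta z) /\
    filterlim
      (fun s => norm_A r (PS_minus (PS_scal (/ s) (PS_minus (Phi t (Q s)) fps_one)) g))
      (at_right 0) (locally 0).
Proof.
  intros Ht Hr [HQin [HQ0 [HQmul HQcont]]] Heta.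
  assert (Hr0 : 0 <= r) by lra.
  set (u := fun s => PS_minus (Phi t (Q s)) fps_one).
  assert (Hu : forall s, 0 <= s -> in_A r (u s)).
  { intros s Hs; apply in_A_minus; [exact Hr0 | now apply HQin | apply in_A_one]. }
  assert (Hcont : filterlim (fun s => norm_A r (u s)) (at_right 0) (locally 0)).
  { refine (filterlim_ext _ _ _ HQcont); intro s; unfold u.
    change (norm_A r (Phi t (PS_minus (Q s) fps_one)) =
            norm_A r (PS_minus (Phi t (Q s)) fps_one)).
    now rewrite !PS_minus_lin, Phi_lin, Phi_one. }
  assert (H8 : 0 < 1 / 8) by lra.
  destruct (proj1 (filterlim_locally _ _) Hcont (mkposreal _ H8)) as [delta Hdelta].
  apply (generator_of_halving r delta u Hr Hu).
  - intros s Hs; unfold u.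
    rewrite PS_mult_minus_one, <- Phi_boxplus, HQmul by auto; reflexivity.
  - intros s Hs.
    assert (H : ball 0 delta s)
      by (change (Rabs (s - 0) < delta); rewrite Rminus_0_r, Rabs_pos_eq; lra).
    specialize (Hdelta s H (proj1 Hs)).
    change (Rabs (norm_A r (u s) - 0) < 1 / 8) in Hdelta.
    rewrite Rminus_0_r in Hdelta; apply Rabs_lt_between in Hdelta; lra.
  - intros z Hz; refine (filterlim_within_ext _ _ _ _ (Heta z Hz)).
    intros s Hs; unfold u.
    rewrite PS_minus_lin, (fps_eval_lin r), fps_eval_one;
      [|exact Hr0 | apply HQin; lra | apply in_A_one | exact Hz].
    replace (-1) with (- (1)) by ring.
    f_equal; rewrite RtoC_opp; ring.
  - apply cond_pos.
  - exact Hcont.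
Qed.

Section Identification.

Variables (t r : R) (Q : R -> fps) (eta : C -> C) (g : fps).
Hypothesis Ht : forall n : nat, t <> INR n.
Hypothesis Hr : 0 < r.
Hypothesis HQ : forall s, 0 <= s -> in_At t r (Q s).
Hypothesis Hg : in_A r g.
Hypothesis Hgev : forall z, Cmod z < r -> fps_eval g z = eta z.
Hypothesis Hder : filterlim
  (fun s => norm_A r (PS_minus (PS_scal (/ s) (PS_minus (Phi t (Q s)) fps_one)) g))
  (at_right 0) (locally 0).

Lemma difference_quotient (s : R) (A B : fps) :
  norm_At t r (PS_minus (PS_scal (/ s) (PS_minus (semigroup_op t Q s A) A)) B) =
  norm_A r (PS_minus
    (PS_mult (Phi t A) (PS_scal (/ s) (PS_minus (Phi t (Q s)) fps_one))) (Phi t B)).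
Proof.
  change (norm_A r (Phi t (PS_minus (PS_scal (/ s)
            (PS_minus (semigroup_op t Q s A) A)) B)) =
    norm_A r (PS_minus
    (PS_mult (Phi t A) (PS_scal (/ s) (PS_minus (Phi t (Q s)) fps_one))) (Phi t B))).
  f_equal.
  rewrite !PS_scal_lin, !PS_minus_lin, PS_mult_lin_r, !PS_mult_lin_r, PS_mult_one_r.
  rewrite !Phi_lin; unfold semigroup_op; now rewrite Phi_boxplus.
Qed.

Lemma difference_quotient_lim (a : fps) :
  in_A r a ->
  filterlim (fun s => norm_A r (PS_minus
      (PS_mult a (PS_scal (/ s) (PS_minus (Phi t (Q s)) fps_one))) (PS_mult a g)))
    (at_right 0) (locally 0).
Proof.
  intro Ha.
  assert (Hr0 : 0 <= r) by lra.
  set (d := fun s => PS_scal (/ s) (PS_minus (Phi t (Q s)) fps_one)).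
  assert (Hna := norm_A_nonneg r a Hr0 Ha).
  apply filterlim_locally; intro eps.
  assert (He : 0 < eps / (norm_A r a + 1))
    by (apply Rdiv_lt_0_compat; [apply cond_pos | lra]).
  destruct (proj1 (filterlim_locally _ _) Hder (mkposreal _ He)) as [e1 He1].
  exists e1; intros s Hball Hs; specialize (He1 s Hball Hs).
  assert (Hd : in_A r (PS_minus (d s) g)).
  { apply in_A_minus; [exact Hr0 | | exact Hg]; apply in_A_scal; [exact Hr0|].
    apply in_A_minus; [exact Hr0 | apply HQ; lra | apply in_A_one]. }
  destruct (in_A_mult r a _ Hr0 Ha Hd) as [Hm Hmn].
  replace (PS_minus (PS_mult a (PS_scal (/ s) (PS_minus (Phi t (Q s)) fps_one)))
             (PS_mult a g))
    with (PS_mult a (PS_minus (d s) g))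
    by now rewrite !(PS_minus_lin _ g), (PS_minus_lin (PS_mult _ _)), PS_mult_lin_r.
  change (Rabs (norm_A r (PS_minus (d s) g) - 0) < eps / (norm_A r a + 1)) in He1.
  change (Rabs (norm_A r (PS_mult a (PS_minus (d s) g)) - 0) < eps).
  rewrite Rminus_0_r in *.
  rewrite Rabs_pos_eq in * by now apply norm_A_nonneg.
  apply Rle_lt_trans with (1 := Hmn).
  assert (Hn0 := norm_A_nonneg r _ Hr0 Hd).
  apply Rlt_div_r in He1; [nra | lra].
Qed.

(** The difference quotients of [Phi t A] are [Phi t A] convolved with those of the
    semigroup, so they converge for every [A], and limits in norm are unique. *)
Lemma generator_eq_convolution (A B : fps) :
  generator t r Q A B <-> in_At t r A /\ B = Phi_inv t (PS_mult (Phi t A) g).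
Proof.
  assert (Hr0 : 0 <= r) by lra.
  split.
  - intros [HA [HB Hlim]]; split; [exact HA|].
    destruct (in_A_mult r _ _ Hr0 HA Hg) as [Hm _].
    replace (PS_mult (Phi t A) g) with (Phi t B); [now rewrite Phi_inv_Phi|].
    symmetry; refine (norm_limit_unique r (at_right 0) (at_right_proper_filter 0)
      _ _ _ Hr Hm HB _ (difference_quotient_lim _ HA) _).
    + exists (mkposreal r Hr); intros s _ Hs.
      apply in_A_mult; [exact Hr0 | exact HA|].
      apply in_A_scal; [exact Hr0|].
      apply in_A_minus; [exact Hr0 | apply HQ; lra | apply in_A_one].
    + refine (filterlim_ext _ _ _ Hlim); intro s; apply difference_quotient.
  - intros [HA ->].
    destruct (in_A_mult r _ _ Hr0 HA Hg) as [Hm _].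
    split; [exact HA|]; split.
    + change (in_A r (Phi t (Phi_inv t (PS_mult (Phi t A) g)))).
      now rewrite Phi_Phi_inv.
    + refine (filterlim_ext _ _ _ (difference_quotient_lim _ HA)); intro s.
      now rewrite difference_quotient, Phi_Phi_inv.
Qed.

(** The function [eta * Phi t A] is always represented by the convolution of
    [Phi t A] with [g], and by [fps_eval_inj] by nothing else. *)
Lemma conj_mul_eq_convolution (A B : fps) :
  conj_mul t r eta A B <-> in_At t r A /\ B = Phi_inv t (PS_mult (Phi t A) g).
Proof.
  assert (Hr0 : 0 <= r) by lra.
  assert (Hrep : in_At t r A -> represents r (mul_fun eta (Phi t A)) (PS_mult (Phi t A) g)).
  { intro HA; split; [now apply in_A_mult|].
    intros z Hz; unfold mul_fun; rewrite (fps_eval_mult r), Hgev by auto; ring. }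
  split.
  - intros [HA [c [[Hc Hcev] ->]]]; split; [exact HA|].
    destruct (Hrep HA) as [Hm Hmev].
    f_equal; apply fps_eval_inj with r; [exact Hr | exact Hc | exact Hm|].
    intros z Hz; now rewrite <- Hcev, <- Hmev.
  - intros [HA ->]; split; [exact HA|].
    exists (PS_mult (Phi t A) g); split; [now apply Hrep | reflexivity].
Qed.

End Identification.

Theorem theorem4p5 :
  forall (t r : R) (Q : R -> fps) (eta : C -> C),
    (forall n : nat, t <> INR n) ->
    0 < r ->
    boxplus_semigroup t r Q ->
    (forall z : C, Cmod z < r ->
       filterlim
         (fun s : R => ((fps_eval (Phi t (Q s)) z - RtoC 1) / RtoC s)%C)
         (at_right 0) (locally (eta z))) ->
    (forall A B : fps, generator t r Q A B <-> conj_mul t r eta A B) /\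
    (forall A : fps,
       Dom (generator t r Q) A <->
       in_At t r A /\ fun_in_A r (mul_fun eta (Phi t A))).
Proof.
  intros t r Q eta Ht Hr HQ Heta.
  destruct (semigroup_norm_derivative t r Q eta Ht Hr HQ Heta) as [g [Hg [Hgev Hder]]].
  assert (Heq : forall A B, generator t r Q A B <-> conj_mul t r eta A B).
  { intros A B.
    rewrite (generator_eq_convolution t r Q g Ht Hr (proj1 HQ) Hg Hder A B).
    symmetry; now apply conj_mul_eq_convolution. }
  split; [exact Heq|].
  intro A; split.
  - intros [B HB]; apply Heq in HB.
    destruct HB as [HA [c [Hc _]]]; split; [exact HA | now exists c].
  - intros [HA [c Hc]].
    exists (Phi_inv t c); apply Heq; split; [exact HA | now exists c].
Qed.
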